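(* For every valid date $D$, every period $p$, every value $v$ and every $r\in\{\downarrow,\uparrow\}$: if $D +_r p \to^* v$ then $v$ is a valid date.
   Context: Values (dates). A value is either the error element $\bot$ or a triple $(y,m,d)$ of integers (year, month, day; January is month $1$); triples need not denote an existing day. ''Date'' means such a value. For an integer $y$ and $1\le m\le 12$, $\mathrm{nb\_days}(y,m)$ is the number of days of month $m$ of year $y$ in the Gregorian calendar: 31 for $m\in\{1,3,5,7,8,10,12\}$, 30 for $m\in\{4,6,9,11\}$, and for $m=2$: 29 if $y$ is leap, else 28, where $y$ is leap iff ($4\mid y$ and $100\nmid y$) or $400\mid y$. A date is valid if it is a triple $(y,m,d)$ with $1\le m\le 12$ and $1\le d\le\mathrm{nb\_days}(y,m)$. Expressions: $e ::= v \mid e +_\delta n \mid \mathrm{rnd}_r\,e$ with $v$ a value, $n\in\mathbb Z$, $\delta\in\{y,m,d\}$ ($+_y,+_m,+_d$: addition of years, months, days) and rounding mode $r\in\{\uparrow,\downarrow,\bot\}$. The small-step relation $\to$ is the least relation with the following rules, and $\to^*$ is its reflexive-transitive closure. Error rules: $\bot+_\delta n\to\bot$; $\mathrm{rnd}_r\bot\to\bot$; if $m\notin[1,12]$ then $(y,m,d)+_\delta n\to\bot$ and $\mathrm{rnd}_r(y,m,d)\to\bot$. All following rules assume $1\le m\le 12$. Congruence: if $e\to e'$ then $e+_\delta n\to e'+_\delta n$ and $\mathrm{rnd}_r e\to\mathrm{rnd}_r e'$. Years: $(y,m,d)+_y n\to(y+n,m,d)$. Months: if $1\le m+n\le 12$,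 $(y,m,d)+_m n\to(y,m+n,d)$; if $m+n<1$, $(y,m,d)+_m n\to(y-1,m,d)+_m(n+12)$; if $m+n>12$, $(y,m,d)+_m n\to(y+1,m,d)+_m(n-12)$. Days: write $N=\mathrm{nb\_days}(y,m)$. - If $d<1$ or $d>N$: $(y,m,d)+_d n\to\bot$. - If $1\le d\le N$ and $1\le d+n\le N$: $(y,m,d)+_d n\to(y,m,d+n)$. - If $1\le d\le N$ and $d+n>N$: $(y,m,d)+_d n\to((y,m,1)+_m 1)+_d(n-(N-d)-1)$. - If $1<d\le N$ and $d+n\le 0$: $(y,m,d)+_d n\to(y,m,1)+_d(d-1+n)$. - If $n+1\le 0$ and $(y,m,1)+_m(-1)\to^*(y',m',d')$ (a triple): $(y,m,1)+_d n\to(y',m',1)+_d(n+\mathrm{nb\_days}(y',m'))$. Rounding, with $N=\mathrm{nb\_days}(y,m)$: if $d<1$, $\mathrm{rnd}_r(y,m,d)\to\bot$ for every $r$; if $1\le d\le N$, $\mathrm{rnd}_r(y,m,d)\to(y,m,d)$ for every $r$; if $d>N$: $\mathrm{rnd}_\bot(y,m,d)\to\bot$, $\mathrm{rnd}_\downarrow(y,m,d)\to(y,m,N)$, and $\mathrm{rnd}_\uparrow(y,m,d)\to(y',m',1)$ where $(y,m,d)+_m 1\to^*(y',m',d')$ (a triple). A period $p$ consists of three integers: $n_y$ years, $n_m$ months, $n_d$ days. For an expression $e$ and rounding mode $r$, $e+_r p := \mathrm{rnd}_r\big((e+_y n_y)+_m n_m\big)+_d n_d$. *)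

(* Defs.v *)
From Stdlib Require Import ZArith Relations.
Open Scope Z_scope.

(* [date y m d] need not denote an existing day. *)
Inductive value : Set :=
| bot : value
| date : Z -> Z -> Z -> value.

Definition leap (y : Z) : bool :=
  ((y mod 4 =? 0) && negb (y mod 100 =? 0)) || (y mod 400 =? 0).

(* Only meaningful for [1 <= m <= 12]; the value 0 elsewhere is arbitrary. *)
Definition nb_days (y m : Z) : Z :=
  match m with
  | 1 | 3 | 5 | 7 | 8 | 10 | 12 => 31
  | 4 | 6 | 9 | 11 => 30
  | 2 => if leap y then 29 else 28
  | _ => 0
  end.

Definition valid (v : value) : Prop :=
  match v with
  | bot => False
  | date y m d => 1 <= m <= 12 /\ 1 <= d <= nb_days y m
  end.

Inductive time_unit : Set := Year | Month | Day.

Inductive rounding : Set := RUp | RDown | RBot.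

Inductive expr : Set :=
| Val : value -> expr
| Add : time_unit -> expr -> Z -> expr
| Rnd : rounding -> expr -> expr.

(* The reflexive-transitive closure of [step] itself occurs, positively, in the
   premises of [step_day_under_first] and [step_rnd_up]. *)
Inductive step : expr -> expr -> Prop :=
| step_add_bot u n :
    step (Add u (Val bot) n) (Val bot)
| step_rnd_bot r :
    step (Rnd r (Val bot)) (Val bot)
| step_add_bad_month u y m d n :
    ~ (1 <= m <= 12) ->
    step (Add u (Val (date y m d)) n) (Val bot)
| step_rnd_bad_month r y m d :
    ~ (1 <= m <= 12) ->
    step (Rnd r (Val (date y m d))) (Val bot)
| step_add_congr u e e' n :
    step e e' ->
    step (Add u e n) (Add u e' n)
| step_rnd_congr r e e' :
    step e e' ->
    step (Rnd r e) (Rnd r e')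
| step_year y m d n :
    1 <= m <= 12 ->
    step (Add Year (Val (date y m d)) n) (Val (date (y + n) m d))
| step_month y m d n :
    1 <= m <= 12 ->
    1 <= m + n <= 12 ->
    step (Add Month (Val (date y m d)) n) (Val (date y (m + n) d))
| step_month_under y m d n :
    1 <= m <= 12 ->
    m + n < 1 ->
    step (Add Month (Val (date y m d)) n)
         (Add Month (Val (date (y - 1) m d)) (n + 12))
| step_month_over y m d n :
    1 <= m <= 12 ->
    m + n > 12 ->
    step (Add Month (Val (date y m d)) n)
         (Add Month (Val (date (y + 1) m d)) (n - 12))
| step_day_bad y m d n :
    1 <= m <= 12 ->
    d < 1 \/ d > nb_days y m ->
    step (Add Day (Val (date y m d)) n) (Val bot)
| step_day y m d n :
    1 <= m <= 12 ->
    1 <= d <= nb_days y m ->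
    1 <= d + n <= nb_days y m ->
    step (Add Day (Val (date y m d)) n) (Val (date y m (d + n)))
| step_day_over y m d n :
    1 <= m <= 12 ->
    1 <= d <= nb_days y m ->
    d + n > nb_days y m ->
    step (Add Day (Val (date y m d)) n)
         (Add Day (Add Month (Val (date y m 1)) 1)
              (n - (nb_days y m - d) - 1))
| step_day_under y m d n :
    1 <= m <= 12 ->
    1 < d <= nb_days y m ->
    d + n <= 0 ->
    step (Add Day (Val (date y m d)) n)
         (Add Day (Val (date y m 1)) (d - 1 + n))
| step_day_under_first y m n y' m' d' :
    1 <= m <= 12 ->
    n + 1 <= 0 ->
    clos_refl_trans expr step
      (Add Month (Val (date y m 1)) (-1)) (Val (date y' m' d')) ->
    step (Add Day (Val (date y m 1)) n)
         (Add Day (Val (date y' m' 1)) (n + nb_days y' m'))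
| step_rnd_bad_day r y m d :
    1 <= m <= 12 ->
    d < 1 ->
    step (Rnd r (Val (date y m d))) (Val bot)
| step_rnd_id r y m d :
    1 <= m <= 12 ->
    1 <= d <= nb_days y m ->
    step (Rnd r (Val (date y m d))) (Val (date y m d))
| step_rnd_error y m d :
    1 <= m <= 12 ->
    d > nb_days y m ->
    step (Rnd RBot (Val (date y m d))) (Val bot)
| step_rnd_down y m d :
    1 <= m <= 12 ->
    d > nb_days y m ->
    step (Rnd RDown (Val (date y m d))) (Val (date y m (nb_days y m)))
| step_rnd_up y m d y' m' d' :
    1 <= m <= 12 ->
    d > nb_days y m ->
    clos_refl_trans expr step
      (Add Month (Val (date y m d)) 1) (Val (date y' m' d')) ->
    step (Rnd RUp (Val (date y m d))) (Val (date y' m' 1)).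

Definition steps : expr -> expr -> Prop := clos_refl_trans expr step.

Record period : Set := Period { p_years : Z; p_months : Z; p_days : Z }.

Definition add_period (r : rounding) (e : expr) (p : period) : expr :=
  Add Day (Rnd r (Add Month (Add Year e (p_years p)) (p_months p))) (p_days p).

(* Main.v *)
Require Import Defs.
From Stdlib Require Import ZArith Lia.
Local Open Scope Z_scope.

(* Year and month additions keep the month in range and leave the day alone, so
   they reach rounding with a day [>= 1], which rounding down or up then makes
   valid.  Day additions only build month additions on the first of a month,
   and that day exists in every month.  Both facts are syntactic invariants of
   reduction. *)

Lemma nb_days_pos (y m : Z) : 1 <= m <= 12 -> 1 <= nb_days y m.
Proof.
  intros Hm.
  assert (m = 1 \/ m = 2 \/ m = 3 \/ m = 4 \/ m = 5 \/ m = 6 \/ m = 7 \/ m = 8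
          \/ m = 9 \/ m = 10 \/ m = 11 \/ m = 12) as H by lia.
  unfold nb_days.
  repeat destruct H as [-> | H]; try subst m; try destruct (leap y); lia.
Qed.

Fixpoint month_shift (P : Z -> Prop) (e : expr) : Prop :=
  match e with
  | Val (date _ m d) => 1 <= m <= 12 /\ P d
  | Add Year e _ | Add Month e _ => month_shift P e
  | _ => False
  end.

(** Induction gives no hypothesis for the reductions nested in premises of [step]; the rules having
    them start from [Add Day] or [Rnd], where [month_shift] is [False]. *)
Lemma month_shift_step (P : Z -> Prop) (e e' : expr) :
  step e e' -> month_shift P e -> month_shift P e'.
Proof.
  induction 1; try (destruct u); simpl in *; intuition.
Qed.

Lemma invariant_steps (I : expr -> Prop) :
  (forall e e', step e e' -> I e -> I e') ->
  forall e e', steps e e' -> I e -> I e'.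
Proof.
  intros HI e e'; induction 1; eauto.
Qed.

Lemma month_add_steps (P : Z -> Prop) (y m d n y' m' d' : Z) :
  1 <= m <= 12 -> P d ->
  steps (Add Month (Val (date y m d)) n) (Val (date y' m' d')) ->
  1 <= m' <= 12 /\ P d'.
Proof.
  intros Hm Hd Hs.
  exact (invariant_steps _ (month_shift_step P) _ _ Hs (conj Hm Hd)).
Qed.

(** Outside rounding nothing repairs the day, so year and month additions need day 1; under rounding
    [1 <= d] suffices. [RBot] is excluded since it can yield [bot]. *)
Fixpoint safe (e : expr) : Prop :=
  match e with
  | Val v => valid v
  | Add Day e _ => safe e
  | Add _ e _ => month_shift (eq 1) e
  | Rnd RBot _ => False
  | Rnd _ e => month_shift (Z.le 1) e
  end.

Lemma safe_step (e e' : expr) : step e e' -> safe e -> safe e'.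
Proof.
  induction 1 as
    [ | | | | u e e' n He IH | r e e' He IH | | | | | | | |
    | y m n y' m' d' Hm Hn Hs | | | | y m d Hm Hd
    | y m d y' m' d' Hm Hd Hs ]; try (destruct u); try (destruct r);
    simpl in *; try tauto; try lia;
    eauto using month_shift_step.
  - intros [Hm <-]; pose proof (nb_days_pos (y + n) m Hm); lia.
  - intros [_ <-]; pose proof (nb_days_pos y (m + n)); lia.
  - intros _.
    (* [m'] comes from a nested reduction, so its range is read off the [month_shift] invariant. *)
    destruct (month_add_steps (eq 1) _ _ _ _ _ _ _ Hm eq_refl Hs) as [Hm' _].
    pose proof (nb_days_pos y' m' Hm'); lia.
  - intros _; pose proof (nb_days_pos y m Hm); lia.
  - intros [_ Hd1].
    destruct (month_add_steps (Z.le 1) _ _ _ _ _ _ _ Hm Hd1 Hs) as [Hm' _].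
    pose proof (nb_days_pos y' m' Hm'); lia.
Qed.

Theorem theorem2 (D : value) (p : period) (v : value) (r : rounding)
  (hD : valid D) (hr : r = RDown \/ r = RUp)
  (hsteps : steps (add_period r (Val D) p) (Val v)) :
  valid v.
Proof.
  (* [safe (Val v)] computes to [valid v]; safety of the initial expression remains. *)
  apply (invariant_steps safe safe_step _ _ hsteps).
  destruct D as [|y m d]; simpl in *; [tauto|].
  destruct hr as [-> | ->]; simpl; lia.
Qed.
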